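(* Let $(G_2)^w=\{\alpha\in G_2\mid w\alpha=\alpha w\}$ and $(G_2)_{e_1}=\{\alpha\in G_2\mid\alpha e_1=e_1\}$. Then $$(G_2)^w=(G_2)_{e_1}\cong SU(3).$$
   Context: $\mathbb H$ is the field of quaternions with basis $1,e_1,e_2,e_3$ ($e_1e_2=e_3$, etc.); the Cayley algebra is $\mathfrak C=\mathbb H\oplus\mathbb He_4$ with multiplication $(m+ae_4)(n+be_4)=(mn-\overline b a)+(a\overline n+bm)e_4$ and the Euclidean inner product for which $1,e_1,e_2,e_3,e_4,e_1e_4,e_2e_4,e_3e_4$ is orthonormal. $G_2$ is the group of $\mathbb R$-linear isomorphisms $\alpha$ of $\mathfrak C$ with $\alpha(xy)=(\alpha x)(\alpha y)$. Let $\mathbf C=\mathbb R+\mathbb Re_1\subset\mathfrak C$ and $\omega_1=-\frac12+\frac{\sqrt3}2e_1\in\mathbf C$. Setting $e_6=-e_2e_4$, every $x\in\mathfrak C$ is uniquely $x=a+m_1e_2+m_2e_4+m_3e_6$ with $a,m_i\in\mathbf C$, and $w:\mathfrak C\to\mathfrak C$ is $w(a+m_1e_2+m_2e_4+m_3e_6)=a+(\omega_1m_1)e_2+(\omega_1m_2)e_4+(\omega_1m_3)e_6$; then $w\in G_2$, $w^3=1$. $\cong$ denotes isomorphism of groups. *)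

(* Defs.v *)
From HB Require Import structures.
From mathcomp Require Import all_boot all_order all_algebra.
From mathcomp Require Import boolp reals.
From mathcomp Require Import complex.
From mathcomp Require Import ring.

Set Implicit Arguments.
Unset Strict Implicit.
Unset Printing Implicit Defensive.

Import Order.TTheory GRing.Theory Num.Theory.
Local Open Scope ring_scope.
Local Open Scope complex_scope.

Reserved Notation "x *o y" (at level 40, left associativity).

Definition isomorphic_groups (G H : groupType) : Prop :=
  exists f : {multiplicative G -> H}, bijective f.

(* The row (a, b, c, d) stands for a + b e1 + c e2 + d e3. *)
Definition quat (R : realType) : Type := 'rV[R]_4.

HB.instance Definition _ (R : realType) := Vector.copy (quat R) 'rV[R]_4.

Definition qc0 (R : realType) (q : quat R) : R := q 0 0.
Definition qc1 (R : realType) (q : quat R) : R := q 0 1.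
Definition qc2 (R : realType) (q : quat R) : R := q 0 2%:R.
Definition qc3 (R : realType) (q : quat R) : R := q 0 3%:R.

Definition mkquat (R : realType) (a b c d : R) : quat R :=
  \row_(i < 4) [:: a; b; c; d]`_i.

Definition qmul (R : realType) (p q : quat R) : quat R :=
  mkquat (qc0 p * qc0 q - qc1 p * qc1 q - qc2 p * qc2 q - qc3 p * qc3 q)
         (qc0 p * qc1 q + qc1 p * qc0 q + qc2 p * qc3 q - qc3 p * qc2 q)
         (qc0 p * qc2 q - qc1 p * qc3 q + qc2 p * qc0 q + qc3 p * qc1 q)
         (qc0 p * qc3 q + qc1 p * qc2 q - qc2 p * qc1 q + qc3 p * qc0 q).

Definition qconj (R : realType) (p : quat R) : quat R :=
  mkquat (qc0 p) (- qc1 p) (- qc2 p) (- qc3 p).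

Lemma mkquatE (R : realType) (a b c d : R) :
  let q := mkquat a b c d in
  (qc0 q = a) * (qc1 q = b) * (qc2 q = c) * (qc3 q = d).
Proof. by do !split; rewrite /qc0 /qc1 /qc2 /qc3 mxE. Qed.

Lemma quatP (R : realType) (p q : quat R) :
  qc0 p = qc0 q -> qc1 p = qc1 q -> qc2 p = qc2 q ->
  qc3 p = qc3 q -> p = q.
Proof.
move=> h0 h1 h2 h3; apply/rowP => -[[|[|[|[|//]]]] lt_i];
  [move: h0 | move: h1 | move: h2 | move: h3];
  by congr (p 0 _ = q 0 _); apply: val_inj.
Qed.

Lemma quatDE (R : realType) (p q : quat R) :
  (qc0 (p + q) = qc0 p + qc0 q) * (qc1 (p + q) = qc1 p + qc1 q) *
  (qc2 (p + q) = qc2 p + qc2 q) * (qc3 (p + q) = qc3 p + qc3 q).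
Proof. by do !split; exact: mxE. Qed.
Lemma quatNE (R : realType) (p : quat R) :
  (qc0 (- p) = - qc0 p) * (qc1 (- p) = - qc1 p) *
  (qc2 (- p) = - qc2 p) * (qc3 (- p) = - qc3 p).
Proof. by do !split; exact: mxE. Qed.
Lemma quatZE (R : realType) (a : R) (p : quat R) :
  (qc0 (a *: p) = a * qc0 p) * (qc1 (a *: p) = a * qc1 p) *
  (qc2 (a *: p) = a * qc2 p) * (qc3 (a *: p) = a * qc3 p).
Proof. by do !split; exact: mxE. Qed.
Lemma quat0E (R : realType) :
  (qc0 (0 : quat R) = 0) * (qc1 (0 : quat R) = 0) *
  (qc2 (0 : quat R) = 0) * (qc3 (0 : quat R) = 0).
Proof. by do !split; exact: mxE. Qed.

Definition quatE := (quatDE, quatNE, quatZE, quat0E, mkquatE).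

Section QuatRing.
Variable R : realType.
Let one : quat R := mkquat 1 0 0 0.

Fact qmulA : associative (@qmul R).
Proof. by move=> p q r; apply: quatP; rewrite !quatE; ring. Qed.
Fact qmul1q : left_id one (@qmul R).
Proof. by move=> p; apply: quatP; rewrite !quatE; ring. Qed.
Fact qmulq1 : right_id one (@qmul R).
Proof. by move=> p; apply: quatP; rewrite !quatE; ring. Qed.
Fact qmulDl : left_distributive (@qmul R) +%R.
Proof. by move=> p q r; apply: quatP; rewrite !quatE; ring. Qed.
Fact qmulDr : right_distributive (@qmul R) +%R.
Proof. by move=> p q r; apply: quatP; rewrite !quatE; ring. Qed.
Fact qone_neq0 : one != 0.
Proof.
apply/eqP => /(congr1 (@qc0 R)); rewrite !quatE.
exact/eqP/oner_neq0.
Qed.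

HB.instance Definition _ := GRing.Zmodule_isNzRing.Build (quat R)
  qmulA qmul1q qmulq1 qmulDl qmulDr qone_neq0.
End QuatRing.

Lemma qmulE (R : realType) (p q : quat R) :
  (qc0 (p * q) = qc0 p * qc0 q - qc1 p * qc1 q
                 - qc2 p * qc2 q - qc3 p * qc3 q) *
  (qc1 (p * q) = qc0 p * qc1 q + qc1 p * qc0 q
                 + qc2 p * qc3 q - qc3 p * qc2 q) *
  (qc2 (p * q) = qc0 p * qc2 q - qc1 p * qc3 q
                 + qc2 p * qc0 q + qc3 p * qc1 q) *
  (qc3 (p * q) = qc0 p * qc3 q + qc1 p * qc2 q
                 - qc2 p * qc1 q + qc3 p * qc0 q).
Proof. by rewrite -[p * q]/(qmul p q) /qmul !mkquatE. Qed.
Lemma qoneE (R : realType) : 1 = mkquat 1 0 0 0 :> quat R.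
Proof. by []. Qed.

(* The pair (m, a) stands for m + a e4.  Only the vector space structure is
   inherited from the product: its componentwise product is not wanted. *)
Definition cayley (R : realType) : Type := (quat R * quat R)%type.

HB.instance Definition _ (R : realType) :=
  Vector.copy (cayley R) (quat R * quat R)%type.

Definition cmul (R : realType) (x y : cayley R) : cayley R :=
  let: (m, a) := x in let: (n, b) := y in
  (m * n - qconj b * a, a * qconj n + b * m).

Notation "x *o y" := (cmul x y) : ring_scope.

Lemma mkquatD (R : realType) (a b c d a' b' c' d' : R) :
  mkquat a b c d + mkquat a' b' c' d' = mkquat (a + a') (b + b') (c + c') (d + d').
Proof. by apply: quatP; rewrite quatE !mkquatE. Qed.
Lemma mkquatN (R : realType) (a b c d : R) :
  - mkquat a b c d = mkquat (- a) (- b) (- c) (- d).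
Proof. by apply: quatP; rewrite quatE !mkquatE. Qed.
Lemma mkquatZ (R : realType) (k a b c d : R) :
  k *: mkquat a b c d = mkquat (k * a) (k * b) (k * c) (k * d).
Proof. by apply: quatP; rewrite quatE !mkquatE. Qed.
Lemma mkquat0 (R : realType) : 0 = mkquat 0 0 0 0 :> quat R.
Proof. by apply: quatP; rewrite quat0E mkquatE. Qed.
Lemma mkquatJ (R : realType) (a b c d : R) :
  qconj (mkquat a b c d) = mkquat a (- b) (- c) (- d).
Proof. by rewrite /qconj !mkquatE. Qed.
Lemma mkquatM (R : realType) (a b c d a' b' c' d' : R) :
  mkquat a b c d * mkquat a' b' c' d' =
  mkquat (a * a' - b * b' - c * c' - d * d') (a * b' + b * a' + c * d' - d * c')
         (a * c' - b * d' + c * a' + d * b') (a * d' + b * c' - c * b' + d * a').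
Proof. by apply: quatP; rewrite qmulE !mkquatE. Qed.
Lemma quatX (R : realType) (p : quat R) : exists a b c d, p = mkquat a b c d.
Proof.
by exists (qc0 p), (qc1 p), (qc2 p), (qc3 p); apply: quatP; rewrite mkquatE.
Qed.

Lemma cmulE (R : realType) (m a n b : quat R) :
  (m, a) *o (n, b) = (m * n - qconj b * a, a * qconj n + b * m).
Proof. by []. Qed.
Lemma cayleyD (R : realType) (m a n b : quat R) :
  (m, a) + (n, b) = (m + n, a + b) :> cayley R.
Proof. by []. Qed.
Lemma cayleyN (R : realType) (m a : quat R) : - (m, a) = (- m, - a) :> cayley R.
Proof. by []. Qed.
Lemma cayleyZ (R : realType) (k : R) (m a : quat R) :
  k *: (m, a) = (k *: m, k *: a) :> cayley R.
Proof. by []. Qed.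

Lemma cmul_mkquat (R : realType) (a b c d p q r t a' b' c' d' p' q' r' t' : R) :
  (mkquat a b c d, mkquat p q r t) *o (mkquat a' b' c' d', mkquat p' q' r' t') =
  (mkquat (a * a' - b * b' - c * c' - d * d'
           - p' * p - q' * q - r' * r - t' * t)
          (a * b' + b * a' + c * d' - d * c'
           - p' * q + q' * p + r' * t - t' * r)
          (a * c' - b * d' + c * a' + d * b'
           - p' * r - q' * t + r' * p + t' * q)
          (a * d' + b * c' - c * b' + d * a'
           - p' * t + q' * r - r' * q + t' * p),
   mkquat (p * a' + q * b' + r * c' + t * d'
           + p' * a - q' * b - r' * c - t' * d)
          (- p * b' + q * a' - r * d' + t * c'
           + p' * b + q' * a + r' * d - t' * c)
          (- p * c' + q * d' + r * a' - t * b'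
           + p' * c - q' * d + r' * a + t' * b)
          (- p * d' - q * c' + r * b' + t * a'
           + p' * d + q' * c - r' * b + t' * a)).
Proof.
rewrite cmulE !mkquatJ; do 4!rewrite [mkquat _ _ _ _ * mkquat _ _ _ _]mkquatM.
rewrite mkquatN !mkquatD.
by congr (mkquat _ _ _ _, mkquat _ _ _ _); ring.
Qed.

Section CayleyUnits.
Variable R : realType.

Definition c1 : cayley R := (1, 0).
Definition e1 : cayley R := (mkquat 0 1 0 0, 0).
Definition e2 : cayley R := (mkquat 0 0 1 0, 0).
Definition e3 : cayley R := (mkquat 0 0 0 1, 0).
Definition e4 : cayley R := (0, 1).
Definition e6 : cayley R := - (e2 *o e4).

(* The subfield R + R e1 of the Cayley algebra. *)
Definition cplx (z : R[i]) : cayley R := complex.Re z *: c1 + complex.Im z *: e1.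

Definition omega1 : R[i] := (- 2^-1) +i* (Num.sqrt 3 / 2).

(* The coordinates a, m1, m2, m3 of x = a + m1 e2 + m2 e4 + m3 e6; see
   [cayley_decomp] and [coord_uniq]. *)
Definition coord0 (x : cayley R) : R[i] := qc0 x.1 +i* qc1 x.1.
Definition coord1 (x : cayley R) : R[i] := qc2 x.1 +i* qc3 x.1.
Definition coord2 (x : cayley R) : R[i] := qc0 x.2 +i* qc1 x.2.
Definition coord3 (x : cayley R) : R[i] := (- qc2 x.2) +i* qc3 x.2.

Definition of_coord (a m1 m2 m3 : R[i]) : cayley R :=
  cplx a + cplx m1 *o e2 + cplx m2 *o e4 + cplx m3 *o e6.

Definition w (x : cayley R) : cayley R :=
  of_coord (coord0 x) (omega1 * coord1 x) (omega1 * coord2 x)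
           (omega1 * coord3 x).

Lemma e6E : e6 = (mkquat 0 0 0 0, mkquat 0 0 (- 1) 0).
Proof.
rewrite /e6 /e2 /e4 cmulE qoneE mkquat0 mkquatJ !mkquatM mkquatN !mkquatD.
by rewrite cayleyN !mkquatN; congr (mkquat _ _ _ _, mkquat _ _ _ _); ring.
Qed.
Lemma cplxE z :
  cplx z = (mkquat (complex.Re z) (complex.Im z) 0 0, mkquat 0 0 0 0).
Proof.
rewrite /cplx /c1 /e1 qoneE mkquat0 !cayleyZ !mkquatZ cayleyD !mkquatD.
by congr (mkquat _ _ _ _, mkquat _ _ _ _); ring.
Qed.
Lemma of_coordE a m1 m2 m3 :
  of_coord a m1 m2 m3 =
  (mkquat (complex.Re a) (complex.Im a) (complex.Re m1) (complex.Im m1),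
   mkquat (complex.Re m2) (complex.Im m2)
          (- complex.Re m3) (complex.Im m3)).
Proof.
case: a m1 m2 m3 => [a a'] [b b'] [c c'] [d d'].
rewrite /of_coord !cplxE e6E /e2 /e4 qoneE mkquat0.
rewrite !cmulE !mkquatJ !mkquatM !mkquatN !mkquatD !cayleyD !mkquatD /=.
by congr (mkquat _ _ _ _, mkquat _ _ _ _); ring.
Qed.

Lemma cayley_decomp x :
  x = of_coord (coord0 x) (coord1 x) (coord2 x) (coord3 x).
Proof.
by case: x => m n; rewrite of_coordE; congr pair; apply: quatP;
  rewrite !quatE /= ?opprK.
Qed.

Lemma coord_uniq a m1 m2 m3 : let x := of_coord a m1 m2 m3 in
  [/\ coord0 x = a, coord1 x = m1, coord2 x = m2 & coord3 x = m3].
Proof.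
rewrite /= of_coordE /coord0 /coord1 /coord2 /coord3 /= !quatE opprK.
by case: a m1 m2 m3 => [? ?] [? ?] [? ?] [? ?].
Qed.

Lemma wE a m1 m2 m3 :
  w (of_coord a m1 m2 m3) =
  of_coord a (omega1 * m1) (omega1 * m2) (omega1 * m3).
Proof. by have [h0 h1 h2 h3] := coord_uniq a m1 m2 m3; rewrite /w h0 h1 h2 h3. Qed.

Lemma omega1_cube : omega1 * (omega1 * omega1) = 1.
Proof.
rewrite /omega1; apply/eqP; rewrite eq_complex /=.
have s3 : Num.sqrt 3 * Num.sqrt 3 = 3 :> R by rewrite -expr2 sqr_sqrtr.
move: (Num.sqrt 3) s3 => s s3.
have h2 : (2 : R) != 0 by rewrite pnatr_eq0.
apply/andP; split; apply/eqP.
  transitivity ((- 1 + 3 * (s * s)) / 8 : R); [by field|].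
  by rewrite s3; field.
transitivity (s * (3 - s * s) / 8 : R); [by field|].
by rewrite s3 subrr mulr0 mul0r.
Qed.

Lemma w3 x : w (w (w x)) = x.
Proof.
have h z : omega1 * (omega1 * (omega1 * z)) = z.
  by rewrite !mulrA -(mulrA omega1) omega1_cube mul1r.
by rewrite [X in w (w X)]/w !wE !h -cayley_decomp.
Qed.

Fact w_linear : linear w.
Proof.
move=> a [m n] [p q]; rewrite /w !of_coordE /coord0 /coord1 /coord2 /coord3 /=.
by congr pair; apply: quatP; rewrite /= !quatE; ring.
Qed.

HB.instance Definition _ :=
  GRing.isLinear.Build R (cayley R) (cayley R) *:%R w w_linear.

Lemma w_mkquat (a b c d p q r t : R) (s : R := Num.sqrt 3 / 2) :
  w (mkquat a b c d, mkquat p q r t) =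
  (mkquat a b (- 2^-1 * c - s * d) (- 2^-1 * d + s * c),
   mkquat (- 2^-1 * p - s * q) (- 2^-1 * q + s * p)
          (- 2^-1 * r + s * t) (- 2^-1 * t - s * r)).
Proof.
rewrite /w of_coordE /coord0 /coord1 /coord2 /coord3 /omega1 /= !mkquatE /s.
by congr (mkquat _ _ _ _, mkquat _ _ _ _); ring.
Qed.

Lemma w_mul x y : w (x *o y) = w x *o w y.
Proof.
have s3 : Num.sqrt 3 ^+ 2 = 3 :> R by rewrite sqr_sqrtr.
case: x y => [m n] [p q].
have [[a [b [c [d ->]]]] [a' [b' [c' [d' ->]]]]] := (quatX m, quatX n).
have [[e [f [g [h ->]]]] [e' [f' [g' [h' ->]]]]] := (quatX p, quatX q).
rewrite cmul_mkquat !w_mkquat cmul_mkquat.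
move: (Num.sqrt 3) s3 => s s3.
have h2 : (2 : R) != 0 by rewrite pnatr_eq0.
by congr (mkquat _ _ _ _, mkquat _ _ _ _); field: s3.
Qed.

Lemma lker_linfun_w : lker (linfun w) == 0%VS.
Proof.
by apply/lker0P => x y; rewrite !lfunE /= => e; rewrite -(w3 x) e w3.
Qed.

End CayleyUnits.

Section G2.
Variable R : realType.

(* A linear endomorphism of a finite-dimensional space with trivial kernel is
   bijective. *)
Definition is_G2 : pred 'End(cayley R) := fun f =>
  (lker f == 0%VS) && `[< forall x y, f (x *o y) = f x *o f y >].

Record G2 := MkG2 { G2val :> 'End(cayley R); G2valP : is_G2 G2val }.

HB.instance Definition _ := [isSub for G2val].
HB.instance Definition _ := [Choice of G2 by <:].

Fact is_G2_comp (f g : G2) : is_G2 (f \o g)%VF.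
Proof.
case: f g => [f /andP[kf /asboolP mf]] [g /andP[kg /asboolP mg]] /=.
apply/andP; split; last by apply/asboolP => x y; rewrite !comp_lfunE mg mf.
by apply/lker0P => x y; rewrite !comp_lfunE => e;
  apply: (can_inj (lker0_lfunK kg)); apply: (can_inj (lker0_lfunK kf)).
Qed.
Fact is_G2_id : is_G2 \1%VF.
Proof.
apply/andP; split; first by apply/lker0P => x y; rewrite !id_lfunE.
by apply/asboolP => x y; rewrite !id_lfunE.
Qed.
Fact is_G2_inv (f : G2) : is_G2 (f^-1)%VF.
Proof.
case: f => [f /andP[kf /asboolP mf]] /=.
apply/andP; split; first by apply/lker0P/(can_inj (lker0_lfunVK kf)).
apply/asboolP => x y; apply: (can_inj (lker0_lfunK kf)).
by rewrite mf !lker0_lfunVK.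
Qed.
Definition G2mul (f g : G2) : G2 := MkG2 (is_G2_comp f g).
Definition G2one : G2 := MkG2 is_G2_id.
Definition G2inv (f : G2) : G2 := MkG2 (is_G2_inv f).

Fact G2mulA : associative G2mul.
Proof. by move=> f g h; apply: val_inj; rewrite /= comp_lfunA. Qed.
Fact G2mul1 : left_id G2one G2mul.
Proof. by move=> f; apply: val_inj; rewrite /= comp_lfun1l. Qed.
Fact G2mulr1 : right_id G2one G2mul.
Proof. by move=> f; apply: val_inj; rewrite /= comp_lfun1r. Qed.
Fact G2mulV : left_inverse G2one G2inv G2mul.
Proof.
by case=> f kf; apply: val_inj; case/andP: (kf) => k _; rewrite /= lker0_compVf.
Qed.
Fact G2mulrV : right_inverse G2one G2inv G2mul.
Proof.
by case=> f kf; apply: val_inj; case/andP: (kf) => k _; rewrite /= lker0_compfV.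
Qed.
HB.instance Definition _ :=
  isGroup.Build G2 G2mulA G2mul1 G2mulr1 G2mulV G2mulrV.

Fact w_is_G2 : is_G2 (linfun (@w R)).
Proof.
apply/andP; split; first exact: lker_linfun_w.
by apply/asboolP => x y; rewrite !lfunE /= w_mul.
Qed.
Definition w_G2 : G2 := MkG2 w_is_G2.

Definition G2_w : pred G2 := fun alpha => (w_G2 * alpha == alpha * w_G2)%g.

Definition G2_e1 : pred G2 := fun alpha => alpha (e1 R) == e1 R.

Fact G2_e1_closed : group_closed G2_e1.
Proof.
split; first by apply/eqP; rewrite /= id_lfunE.
move=> f g /eqP fe /eqP ge; apply/eqP; rewrite /= comp_lfunE.
have /andP[kg _] := G2valP g.
by rewrite -{1}ge lker0_lfunK.
Qed.

Definition G2_e1_group : Type := {alpha : G2 | G2_e1 alpha}.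
HB.instance Definition _ := SubChoice.on G2_e1_group.
HB.instance Definition _ :=
  SubChoice_isSubGroup.Build G2 G2_e1 G2_e1_group G2_e1_closed.

End G2.

Arguments G2_w R alpha : clear implicits.
Arguments G2_e1 R alpha : clear implicits.

Section SU.
Variables (n : nat) (R : realType).

Definition is_SU : pred 'M[R[i]]_n := fun M =>
  (M \is unitarymx) && (\det M == 1).

Record SU := MkSU { SUval :> 'M[R[i]]_n; SUvalP : is_SU SUval }.

HB.instance Definition _ := [isSub for SUval].
HB.instance Definition _ := [Choice of SU by <:].

Fact is_SU_mul (M N : SU) : is_SU (M *m N).
Proof.
case: M N => [M /andP[uM /eqP dM]] [N /andP[uN /eqP dN]] /=.
apply/andP; split; first exact: mul_unitarymx.
by apply/eqP; rewrite det_mulmx dM dN mulr1.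
Qed.
Fact is_SU_one : is_SU 1%:M.
Proof.
rewrite /is_SU det1 eqxx andbT; apply/unitarymxP.
by rewrite trmx1 map_mx1 mulmx1.
Qed.
Fact is_SU_inv (M : SU) : is_SU (invmx M).
Proof.
case: M => [M /andP[uM /eqP dM]] /=.
apply/andP; split; first by rewrite (invmx_unitary uM) trmxC_unitary.
by apply/eqP; rewrite det_inv dM invr1.
Qed.
Definition SUmul (M N : SU) : SU := MkSU (is_SU_mul M N).
Definition SUone : SU := MkSU is_SU_one.
Definition SUinv (M : SU) : SU := MkSU (is_SU_inv M).

Fact SUmulA : associative SUmul.
Proof. by move=> *; apply: val_inj; rewrite /= mulmxA. Qed.
Fact SUmul1 : left_id SUone SUmul.
Proof. by move=> *; apply: val_inj; rewrite /= mul1mx. Qed.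
Fact SUmulr1 : right_id SUone SUmul.
Proof. by move=> *; apply: val_inj; rewrite /= mulmx1. Qed.
Fact SUmulV : left_inverse SUone SUinv SUmul.
Proof.
case=> M hM; apply: val_inj; case/andP: (hM) => uM _ /=.
by rewrite mulVmx // unitarymx_unit.
Qed.
Fact SUmulrV : right_inverse SUone SUinv SUmul.
Proof.
case=> M hM; apply: val_inj; case/andP: (hM) => uM _ /=.
by rewrite mulmxV // unitarymx_unit.
Qed.
HB.instance Definition _ :=
  isGroup.Build SU SUmulA SUmul1 SUmulr1 SUmulV SUmulrV.

End SU.

(* Main.v *)
From HB Require Import structures.
From mathcomp Require Import all_boot all_order all_algebra.
From mathcomp Require Import boolp reals complex ring lra.
Require Import Defs.

(** Writing x = a + m1 e2 + m2 e4 + m3 e6 identifies the Cayley algebra with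
    C + C^3, where C = R + R e1, and the product becomes
      (a + m)(b + n) = (a b - <m, n>) + (a n + conj b m - conj (m x n)),
    with <m, n> = sum_i m_i conj n_i and m x n the complex cross product
    ([coord0_mul], [cvec_mul]).  Everything is read off from this formula.

    Equality of the two subgroups.  The map w is a real polynomial in the
    multiplications by e1: w x = twist e1 x, where e1 (x e1) equals -a + m for
    x = a + m ([w_twist]).  An automorphism f carries twist u x to
    twist (f u) (f x), so it commutes with w as soon as it fixes e1.
    Conversely, if f commutes with w it preserves the fixed points of w, which
    are exactly C; hence f e1 is a square root of -1 in C, that is e1 or -e1.
    Since twist (- e1) multiplies C^3 by the conjugate of omega1 instead of
    omega1, the sign must be + ([twist_opp_e1], [G2_w_e1]).

    Isomorphism with SU(3).  If f fixes e1 it is C-linear and it preserves C^3,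
    because C^3 anticommutes with e1; so f acts as the identity on C and as a
    3 x 3 complex matrix M on C^3 ([coord0_G2], [cvec_G2]).  By the product
    formula, f is multiplicative if and only if M preserves the Hermitian form,
    i.e. is unitary, and conj (M u x M v) = M conj (u x v).  Now
    M u x M v = (adj M)^T (u x v) for every matrix ([cross_mulmx]), and
    adj M = (det M) M^* for unitary M, so that under unitarity the cross product
    condition means det M = 1 ([G2_mx_det], [SU_cross]).  Hence f |-> M is a
    bijection onto SU(3), and it is a morphism since composition of maps
    becomes the matrix product. *)

Set Implicit Arguments.
Unset Strict Implicit.
Unset Printing Implicit Defensive.

Import Order.TTheory GRing.Theory Num.Theory.
Local Open Scope ring_scope.
Local Open Scope complex_scope.

(** * Complex vectors of length 3 and their cross product *)

Lemma ord3P (P : 'I_3 -> Prop) : P 0 -> P 1 -> P 2%:R -> forall i, P i.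
Proof.
move=> P0 P1 P2 [[|[|[|//]]] i_lt];
  [move: P0 | move: P1 | move: P2]; by congr P; apply: val_inj.
Qed.

Lemma sum_ord3 (V : nmodType) (F : 'I_3 -> V) : \sum_i F i = F 0 + F 1 + F 2%:R.
Proof.
rewrite !big_ord_recl big_ord0 addr0 addrA.
by congr (_ + _ + _); congr F; apply: val_inj.
Qed.

Definition cross (K : pzRingType) (u v : 'cV[K]_3) : 'cV[K]_3 :=
  \col_i [:: u 1 0 * v 2%:R 0 - u 2%:R 0 * v 1 0;
             u 2%:R 0 * v 0 0 - u 0 0 * v 2%:R 0;
             u 0 0 * v 1 0 - u 1 0 * v 0 0]`_i.

Lemma cross0v (K : pzRingType) (v : 'cV[K]_3) : cross 0 v = 0.
Proof. by apply/colP; apply: ord3P; rewrite !mxE /= !mul0r subrr. Qed.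

Lemma crossv0 (K : pzRingType) (v : 'cV[K]_3) : cross v 0 = 0.
Proof. by apply/colP; apply: ord3P; rewrite !mxE /= !mulr0 subrr. Qed.

(** The entries of the cofactor matrix are the 2 x 2 minors of A, and minors are
    how A acts on the second exterior power of K^3, which the cross product
    identifies with K^3. *)
Lemma cross_mulmx (K : comNzRingType) (A : 'M[K]_3) (u v : 'cV[K]_3) :
  cross (A *m u) (A *m v) = (\adj A)^T *m cross u v.
Proof.
have det2 (B : 'M[K]_2) : \det B = B 0 0 * B 1 1 - B 0 1 * B 1 0.
  rewrite (expand_det_row _ 0) !big_ord_recl big_ord0 addr0.
  rewrite /cofactor !det_mx11 !mxE /= expr0 expr1 mul1r mulN1r mulrN.
  by congr (_ * _ - _ * _); congr (B _ _); apply: val_inj.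
have l00 : lift (0 : 'I_3) (0 : 'I_2) = 1 by apply: val_inj.
have l01 : lift (0 : 'I_3) (1 : 'I_2) = 2%:R by apply: val_inj.
have l10 : lift (1 : 'I_3) (0 : 'I_2) = 0 by apply: val_inj.
have l11 : lift (1 : 'I_3) (1 : 'I_2) = 2%:R by apply: val_inj.
have l20 : lift (2%:R : 'I_3) (0 : 'I_2) = 0 by apply: val_inj.
have l21 : lift (2%:R : 'I_3) (1 : 'I_2) = 1 by apply: val_inj.
apply/colP; apply: ord3P; rewrite !(mxE, sum_ord3) /=;
  rewrite /cofactor !det2 !mxE !(l00, l01, l10, l11, l20, l21) /=; ring.
Qed.

Lemma conjc_i (R : realType) : conjc 'i%C = - 'i%C :> R[i].
Proof. by apply/eqP; rewrite eq_complex /= oppr0 !eqxx. Qed.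

(** * The Cayley algebra as C + C^3 *)

Definition cvec (R : realType) (x : cayley R) : 'cV[R[i]]_3 :=
  \col_i [:: coord1 x; coord2 x; coord3 x]`_i.

(** The inverse of x |-> (coord0 x, cvec x).  It is locked because otherwise
    unification expands it into eight real coordinates. *)
HB.lock Definition of_cvec (R : realType) (a : R[i]) (v : 'cV[R[i]]_3) :
    cayley R :=
  of_coord a (v 0 0) (v 1 0) (v 2%:R 0).

Lemma of_cvecK (R : realType) (x : cayley R) : of_cvec (coord0 x) (cvec x) = x.
Proof. by rewrite of_cvec.unlock !mxE /= -cayley_decomp. Qed.

Lemma coord0_of_cvec (R : realType) (a : R[i]) v : coord0 (of_cvec a v) = a.
Proof.
by rewrite of_cvec.unlock; have [] := coord_uniq a (v 0 0) (v 1 0) (v 2%:R 0).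
Qed.

Lemma cvec_of_cvec (R : realType) (a : R[i]) v : cvec (of_cvec a v) = v.
Proof.
have [_ h1 h2 h3] := coord_uniq a (v 0 0) (v 1 0) (v 2%:R 0).
by rewrite of_cvec.unlock; apply/colP; apply: ord3P; rewrite mxE.
Qed.

Lemma cayley_eqP (R : realType) (x y : cayley R) :
  coord0 x = coord0 y -> cvec x = cvec y -> x = y.
Proof. by move=> h0 hv; rewrite -(of_cvecK x) h0 hv of_cvecK. Qed.

Lemma coord0D (R : realType) (x y : cayley R) : coord0 (x + y) = coord0 x + coord0 y.
Proof. by apply/eqP; rewrite eq_complex /= !quatE !eqxx. Qed.

Lemma coord0N (R : realType) (x : cayley R) : coord0 (- x) = - coord0 x.
Proof. by apply/eqP; rewrite eq_complex /= !quatE !eqxx. Qed.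

Lemma coord0Z (R : realType) (k : R) (x : cayley R) : coord0 (k *: x) = k%:C * coord0 x.
Proof.
by apply/eqP; rewrite eq_complex /= !quatE; apply/andP; split; apply/eqP; ring.
Qed.

Lemma cvecD (R : realType) (x y : cayley R) : cvec (x + y) = cvec x + cvec y.
Proof.
by apply/colP; apply: ord3P; rewrite !mxE /=; apply/eqP;
  rewrite eq_complex /= !quatE ?opprD !eqxx.
Qed.

Lemma cvecN (R : realType) (x : cayley R) : cvec (- x) = - cvec x.
Proof.
by apply/colP; apply: ord3P; rewrite !mxE /=; apply/eqP;
  rewrite eq_complex /= !quatE !eqxx.
Qed.

Lemma cvecZ (R : realType) (k : R) (x : cayley R) : cvec (k *: x) = k%:C *: cvec x.
Proof.
by apply/colP; apply: ord3P; rewrite !mxE /=; apply/eqP;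
  rewrite eq_complex /= !quatE; apply/andP; split; apply/eqP; ring.
Qed.

Lemma coord0_mul (R : realType) (x y : cayley R) :
  coord0 (x *o y) =
  coord0 x * coord0 y - (map_mx conjc (cvec y)^T *m cvec x) 0 0.
Proof.
case: x y => [m n] [p q]; rewrite mxE sum_ord3 !mxE /=.
apply/eqP; rewrite eq_complex /= !(qmulE, quatE).
by apply/andP; split; apply/eqP; ring.
Qed.

Lemma cvec_mul (R : realType) (x y : cayley R) :
  cvec (x *o y) = coord0 x *: cvec y + conjc (coord0 y) *: cvec x
                  - map_mx conjc (cross (cvec x) (cvec y)).
Proof.
case: x y => [m n] [p q].
apply/colP; apply: ord3P; rewrite !mxE /=; apply/eqP;
  rewrite eq_complex /= !(qmulE, quatE);
  by apply/andP; split; apply/eqP; ring.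
Qed.

Lemma cvec_mul_imag (R : realType) (x y : cayley R) :
  coord0 x = 0 -> coord0 y = 0 ->
  cvec (x *o y) = - map_mx conjc (cross (cvec x) (cvec y)).
Proof. by move=> x0 y0; rewrite cvec_mul x0 y0 conjc0 2!scale0r add0r sub0r. Qed.

Lemma of_cvec0 (R : realType) (c : R[i]) : of_cvec c 0 = cplx c.
Proof.
rewrite of_cvec.unlock of_coordE cplxE !mxE; case: c => a b /=.
by rewrite oppr0.
Qed.

Lemma coord0_cplx (R : realType) (c : R[i]) : coord0 (cplx c) = c.
Proof. by rewrite -of_cvec0 coord0_of_cvec. Qed.

Lemma cvec_cplx (R : realType) (c : R[i]) : cvec (cplx c) = 0.
Proof. by rewrite -of_cvec0 cvec_of_cvec. Qed.

Lemma coord0_cplx_mul (R : realType) (c : R[i]) (x : cayley R) :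
  coord0 (cplx c *o x) = c * coord0 x.
Proof. by rewrite coord0_mul coord0_cplx cvec_cplx mulmx0 mxE subr0. Qed.

Lemma coord0_mul_cplx (R : realType) (c : R[i]) (x : cayley R) :
  coord0 (x *o cplx c) = coord0 x * c.
Proof.
by rewrite coord0_mul coord0_cplx cvec_cplx trmx0 map_mx0 mul0mx mxE subr0.
Qed.

Lemma cvec_cplx_mul (R : realType) (c : R[i]) (x : cayley R) :
  cvec (cplx c *o x) = c *: cvec x.
Proof.
by rewrite cvec_mul coord0_cplx cvec_cplx cross0v map_mx0 scaler0 subr0 addr0.
Qed.

Lemma cvec_mul_cplx (R : realType) (c : R[i]) (x : cayley R) :
  cvec (x *o cplx c) = conjc c *: cvec x.
Proof.
by rewrite cvec_mul coord0_cplx cvec_cplx crossv0 map_mx0 scaler0 subr0 add0r.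
Qed.

Lemma e1_cplx (R : realType) : e1 R = cplx 'i%C.
Proof. by rewrite cplxE /e1 mkquat0. Qed.

Lemma c1_cplx (R : realType) : c1 R = cplx 1.
Proof. by rewrite cplxE /c1 qoneE mkquat0. Qed.

(** * The map w in terms of multiplications by e1 *)

(** For u = e1 and x = a + m with a in C and m in C^3, u (x u) = -a + m; hence
    (x - u (x u)) / 2 = a and (x + u (x u)) / 2 = m, and twist u x is
    a - m / 2 + (sqrt 3 / 2) u m.  Having u as a parameter lets automorphisms
    act on it. *)
Definition twist (R : realType) (u x : cayley R) : cayley R :=
  4^-1 *: (x - 3 *: (u *o (x *o u)) + Num.sqrt 3 *: (u *o (x + u *o (x *o u)))).

Lemma coord0_twist (R : realType) (x : cayley R) :
  coord0 (twist (cplx 'i%C) x) = coord0 x.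
Proof.
rewrite /twist !(coord0Z, coord0D, coord0N, coord0_cplx_mul, coord0_mul_cplx).
case: (coord0 x) => a b; apply/eqP; rewrite eq_complex /=.
by apply/andP; split; apply/eqP; field.
Qed.

Lemma cvec_twist (R : realType) (c : R[i]) (x : cayley R) : c * conjc c = 1 ->
  cvec (twist (cplx c) x) = ((- 2^-1)%:C + (Num.sqrt 3 / 2)%:C * c) *: cvec x.
Proof.
move=> c1.
rewrite /twist !(cvecZ, cvecD, cvecN, cvec_cplx_mul, cvec_mul_cplx).
have cc z : c * (conjc c * z) = z by rewrite mulrA c1 mul1r.
move: (cvec x) => v; apply/colP => i; rewrite !mxE !cc.
case: (v i 0) c {c1 cc} => a b [c d].
by apply/eqP; rewrite eq_complex /=; apply/andP; split; apply/eqP; field.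
Qed.

Lemma coord0_w (R : realType) (x : cayley R) : coord0 (w x) = coord0 x.
Proof.
by rewrite /w; case: (coord_uniq (coord0 x) (omega1 R * coord1 x)
  (omega1 R * coord2 x) (omega1 R * coord3 x)).
Qed.

Lemma cvec_w (R : realType) (x : cayley R) : cvec (w x) = omega1 R *: cvec x.
Proof.
have [_ h1 h2 h3] := coord_uniq (coord0 x) (omega1 R * coord1 x)
  (omega1 R * coord2 x) (omega1 R * coord3 x).
by apply/colP; apply: ord3P; rewrite !mxE.
Qed.

Lemma cplx_omega1 (R : realType) :
  omega1 R = (- 2^-1)%:C + (Num.sqrt 3 / 2)%:C * 'i%C.
Proof.
by apply/eqP; rewrite eq_complex /=; apply/andP; split; apply/eqP; field.
Qed.

Lemma mulicJ (R : realType) : 'i%C * conjc 'i%C = 1 :> R[i].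
Proof. by apply/eqP; rewrite eq_complex /=; apply/andP; split; apply/eqP; ring. Qed.

Lemma w_twist (R : realType) (x : cayley R) : w x = twist (e1 R) x.
Proof.
rewrite e1_cplx; apply: cayley_eqP; first by rewrite coord0_w coord0_twist.
by rewrite cvec_w cvec_twist ?mulicJ // cplx_omega1.
Qed.

Lemma sqrt3_neq0 (R : realType) : Num.sqrt 3 != 0 :> R.
Proof. by rewrite sqrtr_eq0 -ltNge ltr0n. Qed.

Lemma w_fixed (R : realType) (x : cayley R) : w x = x -> x = cplx (coord0 x).
Proof.
move=> wx; rewrite -{1}(of_cvecK x) -of_cvec0; congr of_cvec.
have /eqP : (omega1 R - 1) *: cvec x = 0.
  by rewrite scalerBl scale1r -cvec_w wx subrr.
rewrite scaler_eq0 => /orP[/eqP/(congr1 (@complex.Im R)) /= /eqP|/eqP //].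
by rewrite subr0 mulf_eq0 (negPf (sqrt3_neq0 R)) invr_eq0 pnatr_eq0.
Qed.

(** On C^3 the left-hand side is multiplication by the conjugate of omega1, and
    omega1 is not real. *)
Lemma twist_opp_e1 (R : realType) : twist (- e1 R) (e2 R) <> w (e2 R).
Proof.
have -> : - e1 R = cplx (- 'i%C).
  by rewrite cplxE /e1 mkquat0 /= cayleyN !mkquatN !oppr0.
move/(congr1 (@cvec R)); rewrite cvec_w cvec_twist; last first.
  by rewrite rmorphN mulrNN mulicJ.
move/(congr1 (fun v : 'cV_3 => v 0 0)); rewrite !mxE /= /coord1 /= !mkquatE.
move/eqP; rewrite eq_complex /= => /andP[_ /eqP e].
have /eqP : Num.sqrt 3 = 0 :> R by move: (Num.sqrt 3) e => s; lra.
exact/negP/sqrt3_neq0.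
Qed.

(** * Commuting with w and fixing e1 *)

Section G2Elements.
Variables (R : realType) (f : G2 R).

Lemma G2_mul x y : f (x *o y) = f x *o f y.
Proof. by have /andP[_ /asboolP] := G2valP f. Qed.

Lemma G2D x y : f (x + y) = f x + f y.
Proof. exact: linearD. Qed.

Lemma G2N x : f (- x) = - f x.
Proof. exact: linearN. Qed.

Lemma G2Z k x : f (k *: x) = k *: f x.
Proof. exact: linearZ. Qed.

Lemma G2K x : f (G2inv f x) = x.
Proof. by have /andP[k _] := G2valP f; rewrite lker0_lfunVK. Qed.

(** The image of a unit element under a surjective multiplicative map is a unit
    element, and those are unique. *)
Lemma G2_c1 : f (c1 R) = c1 R.
Proof.
have c1l x : c1 R *o x = x.
  rewrite c1_cplx; apply: cayley_eqP; first by rewrite coord0_cplx_mul mul1r.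
  by rewrite cvec_cplx_mul scale1r.
have c1r x : x *o c1 R = x.
  rewrite c1_cplx; apply: cayley_eqP; first by rewrite coord0_mul_cplx mulr1.
  by rewrite cvec_mul_cplx conjc1 scale1r.
by rewrite -[LHS]c1r -{2}[c1 R]G2K -G2_mul c1l G2K.
Qed.

Lemma G2_twist u x : f (twist u x) = twist (f u) (f x).
Proof. by rewrite /twist !(G2Z, G2D, G2N, G2_mul). Qed.

Lemma G2_w_e1 : (f \in G2_w R) = (f \in G2_e1 R).
Proof.
apply/eqP/eqP => [wf | fe1].
  have {}wf x : w (f x) = f (w x).
    by have := congr1 (fun g : G2 R => g x) wf; rewrite /= !comp_lfunE !lfunE.
  have we1 : w (e1 R) = e1 R.
    rewrite e1_cplx; apply: cayley_eqP; first by rewrite coord0_w.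
    by rewrite cvec_w cvec_cplx scaler0.
  (* f e1 is fixed by w, so it is a complex number z, and z ^+ 2 = -1. *)
  have fe1 := w_fixed (etrans (wf _) (congr1 f we1)).
  set z := coord0 _ in fe1.
  have zz : (z - 'i%C) * (z + 'i%C) = 0.
    have : coord0 (f (e1 R *o e1 R)) = - 1.
      have -> : e1 R *o e1 R = - c1 R.
        rewrite c1_cplx e1_cplx; apply: cayley_eqP.
          by rewrite coord0_cplx_mul coord0N !coord0_cplx -expr2 sqr_i.
        by rewrite cvec_cplx_mul cvecN !cvec_cplx scaler0 oppr0.
      by rewrite G2N G2_c1 coord0N c1_cplx coord0_cplx.
    rewrite G2_mul fe1 coord0_cplx_mul coord0_cplx => zz.
    by rewrite -subr_sqr sqr_i opprK expr2 zz addNr.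
  have /orP[/eqP/subr0_eq|/eqP/addr0_eq] : (z - 'i%C == 0) || ('i%C + z == 0).
  - by rewrite -mulf_eq0 [_ + z]addrC zz.
  - by rewrite fe1 e1_cplx => ->.
  (* If f e1 = - e1, then w = f w f^-1 = twist (- e1). *)
  move=> zi; case: (@twist_opp_e1 R).
  have -> : - e1 R = f (e1 R).
    by rewrite fe1 -zi e1_cplx; apply: cayley_eqP;
      rewrite ?coord0N ?cvecN ?coord0_cplx ?cvec_cplx ?oppr0.
  by rewrite -[e2 R]G2K -G2_twist -w_twist wf.
apply: val_inj; apply/lfunP => x.
by rewrite /= !comp_lfunE !lfunE /= !w_twist G2_twist fe1.
Qed.

End G2Elements.

(** * The complex matrix of an automorphism fixing e1 *)

(** The C-basis of C^3; in the Cayley algebra these are e2, e4 and e6. *)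
Definition imbase (R : realType) (j : 'I_3) : cayley R := of_cvec 0 (delta_mx j 0).

Lemma coord0_imbase (R : realType) j : coord0 (imbase R j) = 0.
Proof. exact: coord0_of_cvec. Qed.

Lemma cvec_imbase (R : realType) j : cvec (imbase R j) = delta_mx j 0.
Proof. exact: cvec_of_cvec. Qed.

Lemma G2_cplx (R : realType) (f : G2 R) c :
  f (e1 R) = e1 R -> f (cplx c) = cplx c.
Proof. by move=> fe1; rewrite /cplx G2D !G2Z G2_c1 fe1. Qed.

Lemma coord0_comb (R : realType) (I : finType) a (b : I -> R[i])
    (y : I -> cayley R) :
  coord0 (cplx a + \sum_i cplx (b i) *o y i) = a + \sum_i b i * coord0 (y i).
Proof.
have c0 : coord0 (0 : cayley R) = 0 by rewrite -(scale0r 0) coord0Z mul0r.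
rewrite coord0D coord0_cplx (big_morph _ (@coord0D R) c0).
by under eq_bigr do rewrite coord0_cplx_mul.
Qed.

Lemma cvec_comb (R : realType) (I : finType) a (b : I -> R[i])
    (y : I -> cayley R) :
  cvec (cplx a + \sum_i cplx (b i) *o y i) = \sum_i b i *: cvec (y i).
Proof.
have c0 : cvec (0 : cayley R) = 0 by rewrite -(scale0r 0) cvecZ scale0r.
rewrite cvecD cvec_cplx add0r (big_morph _ (@cvecD R) c0).
by under eq_bigr do rewrite cvec_cplx_mul.
Qed.

Lemma imbase_decomp (R : realType) (x : cayley R) :
  x = cplx (coord0 x) + \sum_j cplx (cvec x j 0) *o imbase R j.
Proof.
apply: cayley_eqP.
  rewrite coord0_comb big1 ?addr0 // => j _.
  by rewrite coord0_imbase mulr0.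
rewrite cvec_comb; under eq_bigr do rewrite cvec_imbase.
rewrite {1}[cvec x]matrix_sum_delta; apply: eq_bigr => j _.
by rewrite big_ord1.
Qed.

Definition G2_mx (R : realType) (f : G2 R) : 'M[R[i]]_3 :=
  \matrix_(i, j) cvec (f (imbase R j)) i 0.

Section G2Stabilizer.
Variables (R : realType) (f : G2 R).
Hypothesis fe1 : f (e1 R) = e1 R.
Let G2_cplx c := G2_cplx c fe1.

(** The elements of C^3 anticommute with e1, and an element x anticommuting with
    e1 satisfies 2 i coord0 x = 0. *)
Lemma coord0_G2_imbase j : coord0 (f (imbase R j)) = 0.
Proof.
have : f (imbase R j *o e1 R) = - f (e1 R *o imbase R j).
  rewrite -G2N; congr (f _); rewrite e1_cplx; apply: cayley_eqP.
    rewrite coord0N coord0_cplx_mul coord0_mul_cplx coord0_imbase.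
    by rewrite mul0r mulr0 oppr0.
  by rewrite cvecN cvec_cplx_mul cvec_mul_cplx conjc_i scaleNr.
rewrite !G2_mul fe1 e1_cplx => /(congr1 (@coord0 R)).
rewrite coord0N coord0_cplx_mul coord0_mul_cplx mulrC => h.
have {h} : 2 * ('i%C * coord0 (f (imbase R j))) = 0.
  by rewrite mulr_natl mulr2n {1}h addNr.
move/eqP; rewrite !mulf_eq0 pnatr_eq0 eq_complex /= oner_eq0 andbF /=.
by move/eqP.
Qed.

Lemma G2_comb (I : finType) a (b : I -> R[i]) (y : I -> cayley R) :
  f (cplx a + \sum_i cplx (b i) *o y i) = cplx a + \sum_i cplx (b i) *o f (y i).
Proof.
rewrite G2D G2_cplx (big_morph _ (@G2D R f) (linear0 f)).
by under eq_bigr do rewrite G2_mul G2_cplx.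
Qed.

Lemma coord0_G2 x : coord0 (f x) = coord0 x.
Proof.
rewrite {1}[x]imbase_decomp G2_comb coord0_comb big1 ?addr0 // => j _.
by rewrite coord0_G2_imbase mulr0.
Qed.

Lemma cvec_G2 x : cvec (f x) = G2_mx f *m cvec x.
Proof.
rewrite {1}[x]imbase_decomp G2_comb cvec_comb; move: (cvec x) => v.
apply/colP => i; rewrite summxE mxE; apply: eq_bigr => j _.
by rewrite !mxE mulrC.
Qed.

(** The Hermitian form is the C-component of the product, up to sign and
    products of C-components, and f leaves all C-components unchanged. *)
Lemma G2_mx_unitary : map_mx conjc (G2_mx f)^T *m G2_mx f = 1%:M.
Proof.
have herm x y : (map_mx conjc (G2_mx f *m cvec y)^T *m (G2_mx f *m cvec x)) 0 0 =
                (map_mx conjc (cvec y)^T *m cvec x) 0 0.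
  have := coord0_G2 (x *o y).
  by rewrite G2_mul !coord0_mul !coord0_G2 !cvec_G2 => /addrI/oppr_inj.
apply/matrixP => i j; move: (herm (imbase R j) (imbase R i)).
rewrite !cvec_imbase trmx_mul map_mxM !mulmxA -[X in X *m _]mulmxA.
rewrite trmx_delta map_delta_mx /= -!rowE -!colE.
by rewrite ![col _ _ _ _]mxE ![row _ _ _ _]mxE => ->; rewrite !mxE eqxx andbT.
Qed.

Lemma G2_mx_cross u v :
  map_mx conjc (cross (G2_mx f *m u) (G2_mx f *m v)) =
  G2_mx f *m map_mx conjc (cross u v).
Proof.
suff mulf x y : coord0 x = 0 -> coord0 y = 0 -> cvec x = u -> cvec y = v ->
    map_mx conjc (cross (G2_mx f *m u) (G2_mx f *m v)) =
    G2_mx f *m map_mx conjc (cross u v).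
  by apply: (mulf (of_cvec 0 u) (of_cvec 0 v));
    rewrite ?coord0_of_cvec ?cvec_of_cvec.
move=> x0 y0 <- <-; have := cvec_G2 (x *o y).
by rewrite G2_mul !cvec_mul_imag ?coord0_G2 // !cvec_G2 mulmxN => /oppr_inj.
Qed.

(** With M the matrix of f and c any cross product, conj ((adj M)^T c) = M conj c.
    Multiplying by M^* = conj M^T turns the left-hand side into conj (det M c)
    and the right-hand side into conj c; a nonzero c then gives det M = 1. *)
Lemma G2_mx_det : \det (G2_mx f) = 1.
Proof.
pose c : 'cV[R[i]]_3 := cross (delta_mx 0 0) (delta_mx 1 0).
have c2 : c 2%:R 0 = 1 by rewrite !mxE /= mulr1 mulr0 subr0.
have : map_mx conjc (\det (G2_mx f) *: c) = map_mx conjc c.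
  rewrite -mul_scalar_mx -[_%:M]tr_scalar_mx -mul_adj_mx trmx_mul -mulmxA.
  rewrite -cross_mulmx map_mxM G2_mx_cross mulmxA.
  by rewrite G2_mx_unitary mul1mx.
move/matrixP/(_ 2%:R 0); rewrite [LHS]mxE [RHS]mxE => /(can_inj (@conjcK R)).
by rewrite mxE c2 mulr1.
Qed.

Lemma G2_mx_SU : is_SU (G2_mx f).
Proof.
rewrite /is_SU G2_mx_det eqxx andbT; apply/unitarymxP.
exact: mulmx1C G2_mx_unitary.
Qed.

End G2Stabilizer.

(** * The automorphism defined by a matrix of SU(3) *)

Section Rotation.
Variables (R : realType) (M : 'M[R[i]]_3).

Definition rot (x : cayley R) : cayley R := of_cvec (coord0 x) (M *m cvec x).

Lemma coord0_rot x : coord0 (rot x) = coord0 x.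
Proof. exact: coord0_of_cvec. Qed.

Lemma cvec_rot x : cvec (rot x) = M *m cvec x.
Proof. exact: cvec_of_cvec. Qed.

Fact rot_linear : linear rot.
Proof.
move=> k x y; apply: cayley_eqP.
  by rewrite coord0_rot 2!coord0D 2!coord0Z !coord0_rot.
by rewrite cvec_rot 2!cvecD 2!cvecZ !cvec_rot mulmxDr -scalemxAr.
Qed.

HB.instance Definition _ :=
  GRing.isLinear.Build R (cayley R) (cayley R) *:%R rot rot_linear.

Hypothesis SU_M : is_SU M.

Lemma SU_mulmxJ : map_mx conjc M^T *m M = 1%:M.
Proof. by have /andP[/unitarymxP uM _] := SU_M; exact: mulmx1C uM. Qed.

(** For determinant 1 the adjugate is the inverse, which for a unitary matrix is
    the conjugate transpose. *)
Lemma SU_adj : \adj M = map_mx conjc M^T.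
Proof.
have /andP[_ /eqP detM] := SU_M.
by rewrite -[LHS]mul1mx -SU_mulmxJ -mulmxA mul_mx_adj detM mulmx1.
Qed.

Lemma SU_cross u v :
  map_mx conjc (cross (M *m u) (M *m v)) = M *m map_mx conjc (cross u v).
Proof.
rewrite cross_mulmx SU_adj map_mxM map_trmx trmxK; congr (_ *m _).
by apply/matrixP => i j; rewrite mxE mxE; exact: conjcK.
Qed.

Lemma rot_mul x y : rot (x *o y) = rot x *o rot y.
Proof.
apply: cayley_eqP.
  rewrite [RHS]coord0_mul !coord0_rot !cvec_rot coord0_mul; congr (_ - _).
  by rewrite trmx_mul map_mxM mulmxA -[_ *m _ *m M]mulmxA SU_mulmxJ mulmx1.
rewrite [RHS]cvec_mul !coord0_rot !cvec_rot cvec_mul SU_cross.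
by rewrite mulmxBr mulmxDr -!scalemxAr.
Qed.

Lemma rot_inj : injective rot.
Proof.
move=> x y e; apply: cayley_eqP; first by rewrite -coord0_rot e coord0_rot.
rewrite -[LHS]mul1mx -SU_mulmxJ -mulmxA -cvec_rot e cvec_rot.
by rewrite mulmxA SU_mulmxJ mul1mx.
Qed.

Fact rot_is_G2 : is_G2 (linfun rot).
Proof.
apply/andP; split; last by apply/asboolP => x y; rewrite !lfunE /= rot_mul.
by apply/lker0P => x y; rewrite !lfunE /=; exact: rot_inj.
Qed.

Definition rot_G2 : G2 R := MkG2 rot_is_G2.

Lemma rot_G2E x : rot_G2 x = rot x.
Proof. exact: lfunE. Qed.

Lemma rot_G2_e1 : G2_e1 R rot_G2.
Proof.
apply/eqP; rewrite rot_G2E e1_cplx; apply: cayley_eqP.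
  by rewrite coord0_rot.
by rewrite cvec_rot cvec_cplx mulmx0.
Qed.

Lemma G2_mx_rot : G2_mx rot_G2 = M.
Proof.
by apply/matrixP => i j; rewrite mxE rot_G2E cvec_rot cvec_imbase -colE mxE.
Qed.

End Rotation.

(** * The isomorphism *)

Section Isomorphism.
Variable R : realType.

Lemma e1_fixed (f : G2_e1_group R) : val f (e1 R) = e1 R.
Proof. exact/eqP/(valP f). Qed.

Definition toSU (f : G2_e1_group R) : SU 3 R := MkSU (G2_mx_SU (e1_fixed f)).

Definition ofSU (M : SU 3 R) : G2_e1_group R :=
  Sub (rot_G2 (SUvalP M)) (rot_G2_e1 (SUvalP M)).

Fact toSU_multiplicative : {morph toSU : f g / (f * g)%g}.
Proof.
move=> f g; apply: val_inj => /=; apply/matrixP => i j.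
rewrite mxE /= comp_lfunE cvec_G2 ?e1_fixed // !mxE.
by apply: eq_bigr => k _; rewrite !mxE.
Qed.

HB.instance Definition _ := isMultiplicative.Build (G2_e1_group R) (SU 3 R)
  toSU toSU_multiplicative.

Lemma toSU_bij : bijective toSU.
Proof.
exists ofSU => [f | M]; last by apply: val_inj; rewrite /= G2_mx_rot.
do 2!apply: val_inj; apply/lfunP => x /=; rewrite lfunE /=; apply: cayley_eqP.
  by rewrite coord0_rot coord0_G2 ?e1_fixed.
by rewrite cvec_rot cvec_G2 ?e1_fixed.
Qed.

End Isomorphism.

Theorem theorem1p9p4 (R : realType) :
  G2_w R =i G2_e1 R /\ isomorphic_groups (G2_e1_group R) (SU 3 R).
Proof.
split; first exact: G2_w_e1.
by exists (@toSU R); exact: toSU_bij.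
Qed.
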